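(* Let $G$ be a connected graph of order $n$. Then $$\operatorname{th}_{\gamma_P}(G)\le \left\lfloor \frac n3\right\rfloor+2,$$ and this bound is sharp (that is, there exist connected graphs $G$ of some order $n$ with $\operatorname{th}_{\gamma_P}(G)=\left\lfloor \frac n3\right\rfloor+2$).
   Context: All graphs are finite, simple and undirected; the order of $G$ is $n=|V(G)|\ge 1$. Power domination propagation process: start with a set $B\subseteq V(G)$ of filled vertices, all other vertices being unfilled. In time step 1 (the domination step), every neighbor of a vertex of $B$ is filled. In each later time step, every vertex $w$ for which there is a filled vertex $v$ (filled at the end of the previous time step) such that $w$ is the unique unfilled neighbor of $v$ becomes filled (all such fillings are performed simultaneously). Let $B^{[0]}=B$ and let $B^{[i]}$ be the set of vertices filled after time step $i$. The propagation time $\operatorname{pt}_{\gamma_P}(G,B)$ is the least $t\ge 0$ with $B^{[t]}=V(G)$, and $\operatorname{pt}_{\gamma_P}(G,B)=\infty$ if no such $t$ exists. The (sum) throttling number for power domination is $$\operatorname{th}_{\gamma_P}(G)=\min_{1\le k\le n}\ \min_{B\subseteq V(G),\,|B|=k}\bigl(|B|+\operatorname{pt}_{\gamma_P}(G,B)\bigr).$$ *)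

(* Defs.v *)
From mathcomp Require Import all_boot all_order all_algebra.
From mathcomp Require Import boolp constructive_ereal.

Set Implicit Arguments.
Unset Strict Implicit.
Unset Printing Implicit Defensive.

Import Order.TTheory GRing.Theory Num.Theory.

Record sgraph := SGraph {
  vertex :> finType;
  adj : rel vertex;
  adj_sym : symmetric adj;
  adj_irr : irreflexive adj;
  vertex_gt0 : 0 < #|vertex|
}.

Definition graph_connected (G : sgraph) : Prop :=
  forall x y : G, connect (@adj G) x y.

Section PowerDomination.
Variable G : sgraph.
Implicit Types F B : {set G}.

Definition domination_step F : {set G} :=
  F :|: [set w | [exists v in F, adj v w]].

Definition forcing_step F : {set G} :=
  F :|: [set w | [exists v in F, [set u | adj v u & u \notin F] == [set w]]].

Definition filled B (t : nat) : {set G} :=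
  if t is s.+1 then iter s forcing_step (domination_step B) else B.

Definition pd_pt B : \bar int :=
  if pselect (exists t, filled B t == [set: G]) is left ex_t
  then ((ex_minn ex_t)%:Z%:E)%R else +oo%E.

(* Both minima are in the total order \bar int, whose top element +oo is the
   neutral element of the iterated minimum; since B = V(G) propagates in time 0,
   the overall minimum is finite. *)
Definition pd_throttling : \bar int :=
  (\big[Order.min/+oo]_(1 <= k < #|G|.+1)
    \big[Order.min/+oo]_(B : {set G} | #|B| == k) (#|B|%:Z%:E + pd_pt B))%E.

End PowerDomination.

(* Main.v *)
(* For n >= 3, some set of at most n/3 vertices fills G after one domination step
   and one forcing step.  Consider families of disjoint stars (each inside the
   closed neighbourhood of a centre) with at least 3 vertices, and take one whose
   cover D is as large as possible and, among those, whose closed neighbourhood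
   N[D] is as large as possible; there are at most n/3 centres.  Replacing a star
   by one or two stars inside it and the complement of D shows that the centres
   dominate exactly D, that each vertex of D has at most one neighbour outside D,
   and that N[D] is closed under adjacency.  By connectedness N[D] = V(G), so each
   vertex outside D is forced in the second step.  If n <= 2, take B = V(G).  The
   bound is attained by K_2. *)

Require Import Defs.
From mathcomp Require Import all_boot all_order all_algebra.
From mathcomp Require Import boolp constructive_ereal.

Set Implicit Arguments.
Unset Strict Implicit.
Unset Printing Implicit Defensive.

(** * Adjacency, closed neighbourhoods and edge cuts *)

Section StarPacking.
Variable G : sgraph.
Implicit Types (A T D : {set G}) (P Q : {set {set G}}) (c u v w x : G).

Lemma adj_swap u v : adj u v -> adj v u.
Proof. by rewrite adj_sym. Qed.

Lemma adjxx u : adj u u = false.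
Proof. exact: adj_irr. Qed.

Lemma domination_stepP D w :
  reflect (w \in D \/ exists2 v, v \in D & adj v w) (w \in domination_step D).
Proof.
rewrite !inE; apply: (iffP orP) => -[Dw | Dw]; [by left | right | by left | right].
  by have [v /andP[Dv vw]] := existsP Dw; exists v.
by have [v Dv vw] := Dw; apply/existsP; exists v; rewrite Dv.
Qed.

(** If no edge left [D], then [D] would be closed under adjacency, hence a union of connected
    components. *)
Lemma cut_edge D : graph_connected G -> D != set0 -> D != setT ->
  exists u v, [/\ u \in D, v \notin D & adj u v].
Proof.
move=> conG /set0Pn[x Dx] DnT.
case: (pickP (fun p : G * G => [&& p.1 \in D, p.2 \notin D & adj p.1 p.2])).
  by move=> [u v] /and3P[]; exists u, v.
move=> noedge; case/eqP: DnT; apply/setP=> y; rewrite inE.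
have clD : closed (@adj G) (mem D).
  apply: intro_closed => [|u v uv Du]; first exact/sym_connect_sym/adj_sym.
  by apply: contraFT (noedge (u, v)) => nDv; rewrite /= Du nDv uv.
by rewrite -(closed_connect clD (conG x y)) Dx.
Qed.

(** * Stars on at least three vertices *)

Definition star_at c T : bool :=
  (c \in T) && [forall x in T, (x != c) ==> adj c x].

(** Edges between leaves are allowed. The minimum of three vertices is what turns disjoint stars
    into at most n/3 centres. *)
Definition star T : bool := (2 < #|T|) && [exists c, star_at c T].

Lemma star_atP c T :
  reflect (c \in T /\ {in T, forall x, x != c -> adj c x}) (star_at c T).
Proof.
apply: (iffP andP) => -[cT sT]; split=> //.
  by move=> x xT xc; apply: (implyP (forall_inP sT x xT)).
by apply/forall_inP=> x xT; apply/implyP/sT.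
Qed.

Lemma star_atU1 c A : 1 < #|A| -> {in A, forall x, adj c x} ->
  star (c |: A) /\ #|c |: A| = #|A|.+1.
Proof.
move=> A2 cA; have cnA : c \notin A by apply/negP=> /cA; rewrite adjxx.
have cardU : #|c |: A| = #|A|.+1 by rewrite cardsU1 cnA.
split=> //; rewrite /star cardU ltnS A2; apply/existsP; exists c.
apply/star_atP; rewrite setU11; split=> // x.
by rewrite !inE => /predU1P[-> | /cA //]; rewrite eqxx.
Qed.

Lemma star3 c x y : adj c x -> adj c y -> x != y ->
  star [set c; x; y] /\ #|[set c; x; y]| = 3.
Proof.
move=> cx cy xy; rewrite -setUA.
have [||st ->] := @star_atU1 c [set x; y].
- by rewrite cards2 xy.
- by move=> z /set2P[] ->.
by rewrite cards2 xy.
Qed.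

Lemma star4 c x y z : adj c x -> adj c y -> adj c z ->
  x != y -> x != z -> y != z ->
  star (c |: [set x; y; z]) /\ #|c |: [set x; y; z]| = 4.
Proof.
move=> cx cy cz xy xz yz.
have card3 : #|[set x; y; z]| = 3.
  by rewrite -setUA cardsU1 cards2 yz !inE (negPf xy) (negPf xz).
have [||st ->] := @star_atU1 c [set x; y; z].
- by rewrite card3.
- by move=> t; rewrite !inE -orbA => /or3P[] /eqP->.
by rewrite card3.
Qed.

Lemma starD1 c v T : star_at c T -> 3 < #|T| -> v \in T -> v != c ->
  star (T :\ v) /\ #|T :\ v|.+1 = #|T|.
Proof.
move=> /star_atP[cT sT] T4 vT vc; have cardT := cardsD1 v T.
rewrite vT add1n in cardT.
split=> //; rewrite /star -ltnS -cardT T4; apply/existsP; exists c.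
apply/star_atP; split=> [|x]; first by rewrite !inE eq_sym vc.
by case/setD1P=> _; apply: sT.
Qed.

(** * Packings of disjoint stars and exchanges *)

Definition star_packing P : bool := trivIset P && [forall T in P, star T].

Lemma star_packingP P :
  reflect (trivIset P /\ {in P, forall T, star T}) (star_packing P).
Proof. by apply: (iffP andP) => -[triP /forall_inP]. Qed.

Lemma star_packing1 A : star A -> star_packing [set A].
Proof. by move=> sA; apply/star_packingP; split; [exact: trivIset1 | move=> T /set1P->]. Qed.

Lemma star_packingU P Q : star_packing P -> star_packing Q ->
  [disjoint cover P & cover Q] -> star_packing (P :|: Q).
Proof.
move=> /star_packingP[tP sP] /star_packingP[tQ sQ] dPQ.
apply/star_packingP; split; first exact: trivIsetU.
by move=> T /setUP[/sP | /sQ].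
Qed.

Lemma coverU P Q : cover (P :|: Q) = cover P :|: cover Q.
Proof. exact: bigcup_setU. Qed.

(** The stars of [Q] use only [T] and uncovered vertices, so they miss the other stars of [P]. The
    count is additive to avoid truncated subtraction. *)
Lemma star_packing_exchange P T Q : star_packing P -> T \in P ->
  star_packing Q -> cover Q \subset T :|: ~: cover P ->
  [/\ star_packing (Q :|: (P :\ T)),
      cover (Q :|: (P :\ T)) = cover Q :|: (cover P :\: T) &
      #|cover (Q :|: (P :\ T))| + #|T| = #|cover Q| + #|cover P|].
Proof.
move=> spP TP spQ sQT; have [tP sP] := star_packingP _ spP.
have TD : T \subset cover P by apply: bigcup_sup TP.
have dQ : [disjoint cover Q & cover P :\: T].
  rewrite -setI_eq0; apply/eqP/setP=> x; rewrite !inE.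
  apply/negbTE/negP=> /and3P[/(subsetP sQT) + nTx Dx].
  by rewrite !inE (negPf nTx) Dx.
have coverE : cover (Q :|: (P :\ T)) = cover Q :|: (cover P :\: T).
  by rewrite coverU coverD1.
split=> //.
  apply: star_packingU => //; last by rewrite coverD1.
  apply/star_packingP; split; first exact: trivIsetS (subsetDl _ _) tP.
  by move=> A /setD1P[_ /sP].
rewrite coverE cardsU disjoint_setI0 // cards0 subn0 -addnA.
by rewrite cardsD (setIidPr TD) subnK // subset_leq_card.
Qed.

(* Lexicographic comparison of the two cardinals, as the second is at most [#|G|]. *)
Definition packing_weight P : nat :=
  #|cover P| * #|G|.+1 + #|domination_step (cover P)|.

Definition max_packing P : Prop :=
  star_packing P /\
  forall Q, star_packing Q -> packing_weight Q <= packing_weight P.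

Lemma max_packing_exists : exists P, max_packing P.
Proof.
have sp0 : star_packing set0.
  by apply/star_packingP; split=> [|T]; [apply/trivIsetP=> A B | ]; rewrite inE.
case: (arg_maxnP packing_weight sp0) => P spP maxP.
by exists P.
Qed.

(** * Properties of a maximal packing *)

Section Maximal.
Variable P : {set {set G}}.
Hypothesis maxP : max_packing P.
Let D := cover P.

(** One more covered vertex gains [#|G|.+1], more than the neighbourhood term can lose. *)
Lemma max_packing_leq_cover Q : star_packing Q -> #|cover Q| <= #|D|.
Proof.
move=> /(maxP.2); rewrite leqNgt; apply: contraNleq => ltDQ.
rewrite /packing_weight -/D.
apply: leq_trans (leq_addr _ _); apply: leq_trans (_ : #|D|.+1 * #|G|.+1 <= _).
  by rewrite mulSn addnC ltn_add2r ltnS max_card.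
by rewrite leq_mul2r ltDQ orbT.
Qed.

Lemma max_packing_leq_nbhd Q : star_packing Q -> #|cover Q| = #|D| ->
  #|domination_step (cover Q)| <= #|domination_step D|.
Proof. by move=> /(maxP.2) + eqD; rewrite /packing_weight eqD -/D leq_add2l. Qed.

(** Exchanging [T] for [A] must not enlarge the cover. *)
Lemma max_packing_star1 T A : T \in P -> star A -> A \subset T :|: ~: D ->
  #|A| <= #|T|.
Proof.
move=> TP sA sAT.
have [||sp _] := @star_packing_exchange P T [set A] maxP.1 TP.
- exact: star_packing1.
- by rewrite cover1.
rewrite cover1 => eqc; have := max_packing_leq_cover sp.
by rewrite -(leq_add2r #|T|) eqc addnC leq_add2l.
Qed.

Lemma max_packing_star2 T A B : T \in P -> star A -> star B ->
  A \subset T :|: ~: D -> B \subset T :|: ~: D -> [disjoint A & B] ->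
  #|A| + #|B| <= #|T|.
Proof.
move=> TP sA sB sAT sBT dAB.
have coverAB : cover ([set A] :|: [set B]) = A :|: B by rewrite coverU !cover1.
have [||sp _] := @star_packing_exchange P T ([set A] :|: [set B]) maxP.1 TP.
- by apply: star_packingU; rewrite ?cover1 //; apply: star_packing1.
- by rewrite coverAB subUset sAT.
rewrite coverAB cardsU disjoint_setI0 // cards0 subn0 => eqc.
have := max_packing_leq_cover sp.
by rewrite -(leq_add2r #|T|) eqc addnC leq_add2l.
Qed.

(** An uncovered neighbour of the centre could be added to [T] as a leaf. *)
Lemma max_packing_center T c u : T \in P -> star_at c T -> adj c u -> u \in D.
Proof.
move=> TP sT cu; have [cT adjT] := star_atP _ _ sT.
apply: contraT => nDu.
have uT : u \notin T.
  by apply: contra nDu; apply: (subsetP (bigcup_sup _ TP)).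
have starT : star T by have [_ ->] := star_packingP _ maxP.1.
have: #|u |: T| <= #|T|.
  apply: max_packing_star1 => //.
    rewrite /star cardsU1 uT ltnS ltnW; last by case/andP: starT.
    apply/existsP; exists c; apply/star_atP; split=> [|x]; first by rewrite !inE cT orbT.
    by rewrite !inE => /predU1P[-> | /adjT].
  by apply/subsetP=> x; rewrite !inE => /predU1P[-> | ->//]; rewrite nDu orbT.
by rewrite cardsU1 uT ltnn.
Qed.

Lemma max_packing_leaf v u : v \in D -> adj v u -> u \notin D ->
  exists T c, [/\ T \in P, star_at c T, v \in T, v != c & adj c v].
Proof.
move=> Dv vu nDu; have [tP sP] := star_packingP _ maxP.1.
have TP := pblock_mem Dv; have /andP[_ /existsP[c sT]] := sP _ TP.
have vT : v \in pblock P v by rewrite mem_pblock.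
have vc : v != c.
  by apply: contraNneq nDu => vc; apply: max_packing_center TP sT _; rewrite -vc.
exists (pblock P v), c; split=> //.
by have [_ ->] := star_atP _ _ sT.
Qed.

(** If [T] had four or more vertices, it would remain a star without [v]; adding [A] would then lose
    one vertex and gain at least three. *)
Lemma max_packing_no_big_star T c v A : T \in P -> star_at c T -> v \in T ->
  v != c -> star A -> A \subset v |: ~: D -> #|T| = 3.
Proof.
move=> TP sT vT vc sA sAv.
have: star T by have [_ ->] := star_packingP _ maxP.1.
case/andP=> T3 _; apply/eqP; rewrite eqn_leq T3 andbT leqNgt; apply/negP=> T4.
have TD := subsetP (bigcup_sup _ TP : T \subset D).
have [sTv cardTv] := starD1 sT T4 vT vc.
have: #|T :\ v| + #|A| <= #|T|.
  apply: max_packing_star2 => //.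
  - by apply/subsetP=> x /setD1P[_]; rewrite !inE => ->.
  - by apply: subset_trans sAv _; rewrite setSU // sub1set.
  rewrite -setI_eq0; apply/eqP/setP=> x; rewrite !inE.
  apply/negbTE/negP=> /andP[/andP[xv xT] /(subsetP sAv)].
  by rewrite !inE (negPf xv) (TD _ xT).
by case/andP: sA => A3 _; rewrite -cardTv -(addn1 #|_|) leq_add2l leqNgt (ltnW A3).
Qed.

(** If [u1] and [u2] differ, the star on [v], [u1], [u2] forces [T] to have three vertices; then [v]
    with leaves [c], [u1], [u2] is a larger star. *)
Lemma max_packing_uniq v u1 u2 : v \in D -> adj v u1 -> adj v u2 ->
  u1 \notin D -> u2 \notin D -> u1 = u2.
Proof.
move=> Dv vu1 vu2 nDu1 nDu2; apply/eqP; apply: contraT => u12.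
have [T [c [TP sT vT vc cv]]] := max_packing_leaf Dv vu1 nDu1.
have TD := subsetP (bigcup_sup _ TP : T \subset D).
have [cT _] := star_atP _ _ sT.
have cu u : u \notin D -> c != u by apply: contraNneq => <-; apply: TD.
have [sA _] := star3 vu1 vu2 u12.
have T3 : #|T| = 3.
  apply: max_packing_no_big_star TP sT vT vc sA _.
  apply/subsetP=> x; rewrite !inE -orbA.
  by case/or3P=> /eqP->; rewrite ?eqxx // ?nDu1 ?nDu2 orbT.
have [sB cB] := star4 (adj_swap cv) vu1 vu2 (cu _ nDu1) (cu _ nDu2) u12.
have: #|v |: [set c; u1; u2]| <= #|T|.
  apply: max_packing_star1 => //; apply/subsetP=> x; rewrite !inE -!orbA.
  by case/or4P=> /eqP->; rewrite ?vT ?cT ?nDu1 ?nDu2 ?orbT.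
by rewrite cB T3.
Qed.

(** Otherwise [u2] is at distance two from [D], via [u] and a leaf [v] of some [T]. Maximality of
    the cover gives [T] exactly three vertices [c], [v], [w], with no edge from [w] out of [D];
    swapping [w] for [u] then enlarges the neighbourhood. *)
Lemma max_packing_adjacent u : u \in domination_step D ->
  forall u2, adj u u2 -> u2 \in domination_step D.
Proof.
move=> Nu u2 uu2; apply: contraT => nNu2.
have nDu2 : u2 \notin D by apply: contra nNu2 => ?; apply/domination_stepP; left.
have nadj x : x \in D -> adj x u2 = false.
  by move=> Dx; apply: contraNF nNu2 => ?; apply/domination_stepP; right; exists x.
have nDu : u \notin D by apply: contraTN uu2 => /nadj->.
have [v Dv vu] : exists2 v, v \in D & adj v u.
  by case/domination_stepP: Nu => // Du; rewrite Du in nDu.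
have [T [c [TP sT vT vc cv]]] := max_packing_leaf Dv vu nDu.
have TD := subsetP (bigcup_sup _ TP : T \subset D).
have [cT adjT] := star_atP _ _ sT.
have neqD x y : x \in D -> y \notin D -> x != y.
  by move=> Dx; apply: contraNneq => <-.
have nDneq x y : x \notin D -> y \in D -> x != y.
  by move=> nDx Dy; rewrite eq_sym; apply: neqD.
have [sA cA] := star3 uu2 (adj_swap vu) (nDneq _ _ nDu2 Dv).
have T3 : #|T| = 3.
  apply: max_packing_no_big_star TP sT vT vc sA _.
  apply/subsetP=> x; rewrite !inE -orbA.
  by case/or3P=> /eqP->; rewrite ?eqxx // ?nDu ?nDu2 orbT.
have [w Tcv] : exists w, T :\ c :\ v = [set w].
  by apply/cards1P; move: T3; rewrite (cardsD1 c) cT (cardsD1 v (_ :\ _)) !inE vc vT !add1n => -[->].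
have /setD1P[wv /setD1P[wc wT]] : w \in T :\ c :\ v by rewrite Tcv set11.
have TE x : x \in T -> [\/ x = c, x = v | x = w].
  move=> xT; have [|xc] := eqVneq x c; first by constructor 1.
  have [|xv] := eqVneq x v; first by constructor 2.
  by constructor 3; apply/set1P; rewrite -Tcv !inE xv xc.
have Dc := TD _ cT; have Dw := TD _ wT.
have vw : v != w by rewrite eq_sym.
(* Otherwise [u] with leaves [u2], [v], [w] is a four-vertex star replacing [T]. *)
have wu : adj w u = false.
  apply/negP=> wu.
  have uv := adj_swap vu.
  have uw := adj_swap wu.
  have [sB cB] := star4 uu2 uv uw (nDneq _ _ nDu2 Dv)
    (nDneq _ _ nDu2 Dw) vw.
  have: #|u |: [set u2; v; w]| <= #|T|.
    apply: max_packing_star1 => //; apply/subsetP=> x; rewrite !inE -!orbA.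
    by case/or4P=> /eqP->; rewrite ?vT ?wT ?nDu ?nDu2 ?orbT.
  by rewrite cB T3.
(* Otherwise [T] could be replaced by two disjoint stars: [u] with leaves [u2], [v], and [w] with
   leaves [c], [x]. *)
have wD x : adj w x -> x \in D.
  move=> wx; apply: contraT => nDx.
  have xu : x != u by apply: contraTneq wx => ->; rewrite wu.
  have xu2 : x != u2 by apply: contraTneq wx => ->; rewrite nadj.
  have [sB cB] := star3 (adj_swap (adjT _ wT wc)) wx (neqD _ _ Dc nDx).
  have: #|[set u; u2; v]| + #|[set w; c; x]| <= #|T|.
    apply: max_packing_star2 => //.
    - apply/subsetP=> y; rewrite !inE -!orbA.
      by case/or3P=> /eqP->; rewrite ?vT ?nDu ?nDu2 ?orbT.
    - apply/subsetP=> y; rewrite !inE -!orbA.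
      by case/or3P=> /eqP->; rewrite ?cT ?wT ?nDx ?orbT.
    rewrite -setI_eq0; apply/eqP/setP=> y; rewrite !inE -!orbA.
    apply/negbTE/negP=> /andP[/or3P[] /eqP->].
    + by rewrite (negPf (nDneq _ _ nDu Dw)) (negPf (nDneq _ _ nDu Dc)) eq_sym (negPf xu).
    + by rewrite (negPf (nDneq _ _ nDu2 Dw)) (negPf (nDneq _ _ nDu2 Dc)) eq_sym (negPf xu2).
    + by rewrite (negPf vw) (negPf vc) (negPf (neqD _ _ Dv nDx)).
  by rewrite cA cB T3.
(* The swap [c; v; w] -> [v; c; u] keeps the size of the cover; as all
   neighbours of [w] are covered, it only loses [w] from the cover, which
   stays adjacent to [c], and it brings [u2] next to the cover. *)
have [sB cB] := star3 (adj_swap cv) vu (neqD _ _ Dc nDu).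
have [||sp coverE cardE] := @star_packing_exchange P T [set [set v; c; u]] maxP.1 TP.
- exact: star_packing1.
- rewrite cover1; apply/subsetP=> y; rewrite !inE -!orbA.
  by case/or3P=> /eqP->; rewrite ?cT ?vT ?nDu ?orbT.
set P' := _ :|: _ in sp coverE cardE; rewrite cover1 in coverE cardE.
have inD' x : x \in D -> x != w -> x \in cover P'.
  move=> Dx xw; rewrite coverE !inE -/D Dx andbT.
  have [/TE[xE | xE | xE] | xnT] := boolP (x \in T).
  - by rewrite xE eqxx orbT.
  - by rewrite xE eqxx.
  - by rewrite xE eqxx in xw.
  - by rewrite orbT.
have uD' : u \in cover P' by rewrite coverE !inE eqxx orbT.
have eqcard : #|cover P'| = #|D|.
  by apply/eqP; rewrite -(eqn_add2r 3) -{1}T3 cardE cB addnC.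
have: #|u2 |: domination_step D| <= #|domination_step (cover P')|.
  apply: subset_leq_card; apply/subsetP=> y /setU1P[-> | ].
    by apply/domination_stepP; right; exists u.
  have cD' : c \in cover P'.
    by apply: inD' => //; rewrite eq_sym.
  have inN x : x \in D -> x \in domination_step (cover P').
    move=> Dx; apply/domination_stepP; have [-> | xw] := eqVneq x w.
      by right; exists c => //; apply: adjT.
    by left; apply: inD'.
  case/domination_stepP=> [/inN // | [x Dx xy]].
  (* A neighbour of the discarded [w] lies in [D], so it is not lost. *)
  have [xw | xw] := eqVneq x w; first by apply: inN; apply: wD; rewrite -xw.
  by apply/domination_stepP; right; exists x => //; apply: inD'.
by rewrite cardsU1 nNu2 add1n leqNgt ltnS max_packing_leq_nbhd.
Qed.

(** Two successive cut edges give a path on three vertices, which is a star. *)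
Lemma max_packing_nonempty : graph_connected G -> 2 < #|G| -> D != set0.
Proof.
move=> conG G3; apply/negP=> /eqP D0.
have nT A : #|A| < 3 -> A != setT.
  by apply: contraTneq => ->; rewrite cardsT -leqNgt.
have [x _] : exists x : G, true by have /card_gt0P[x] := @vertex_gt0 G; exists x.
have [|| x' [y []]] := @cut_edge [set x] conG.
- by apply/set0Pn; exists x; rewrite set11.
- by apply: nT; rewrite cards1.
move=> /set1P->{x'} _ xy.
have [|| v [z []]] := @cut_edge [set x; y] conG.
- by apply/set0Pn; exists x; rewrite set21.
- by apply: nT; rewrite cards2; case: eqP.
rewrite !inE negb_or => vxy /andP[zx zy] vz.
have [A sA] : exists A, star A.
  have yz : y != z by rewrite eq_sym.
  have xz : x != z by rewrite eq_sym.
  (* The centre is whichever of [x], [y] the new vertex [z] is attached to. *)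
  case/orP: vxy vz => /eqP-> vz.
    by exists [set x; y; z]; case: (star3 xy vz yz).
  by exists [set y; x; z]; case: (star3 (adj_swap xy) vz xz).
have := max_packing_leq_cover (star_packing1 sA).
by rewrite cover1 D0 cards0 leqn0; case/andP: sA; case: #|A|.
Qed.

Lemma max_packing_nbhd_full :
  graph_connected G -> 2 < #|G| -> domination_step D = setT.
Proof.
move=> conG G3; apply/eqP; apply: contraT => NnT.
have [x Dx] := set0Pn _ (max_packing_nonempty conG G3).
have [|u [v [Nu /negP nNv uv]]] := cut_edge conG _ NnT.
  by apply/set0Pn; exists x; apply/domination_stepP; left.
by case: nNv; apply: max_packing_adjacent uv.
Qed.

Lemma max_packing_card : 3 * #|P| <= #|G|.
Proof.
have [/eqP tP sP] := star_packingP _ maxP.1.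
apply: leq_trans (max_card (mem D)); rewrite -tP mulnC -sum_nat_const.
by apply: leq_sum => T /sP /andP[].
Qed.

Lemma max_packing_centers : exists2 B : {set G}, #|B| <= #|P| & domination_step B = D.
Proof.
have [tP sP] := star_packingP _ maxP.1.
(* The arbitrary default vertex makes [ctr] total; on members of [P] the [pick] succeeds. *)
pose ctr T := odflt (xchoose (card_gt0P (vertex_gt0 G))) [pick c | star_at c T].
have ctrP T : T \in P -> star_at (ctr T) T.
  move=> /sP /andP[_ /existsP[c sT]]; rewrite /ctr.
  by case: pickP => // /(_ c); rewrite sT.
exists [set ctr T | T in P]; first exact: leq_imset_card.
have subD T : T \in P -> T \subset D by move=> TP; apply: bigcup_sup TP.
apply/setP=> x; apply/domination_stepP/idP.
  case=> [/imsetP[T TP ->] | [_ /imsetP[T TP ->]]].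
    by have [cT _] := star_atP _ _ (ctrP T TP); apply: subsetP (subD T TP) _ cT.
  exact: max_packing_center (ctrP T TP).
case/bigcupP=> T TP xT; have [_ adjT] := star_atP _ _ (ctrP T TP).
have [-> | xc] := eqVneq x (ctr T); first by left; apply: imset_f.
by right; exists (ctr T); [apply: imset_f | apply: adjT].
Qed.

End Maximal.

(** * Filling the graph in two steps from the centres *)

Lemma two_step_power_domination : graph_connected G -> 2 < #|G| ->
  exists B : {set G}, [/\ 0 < #|B|, #|B| <= #|G| %/ 3 & filled B 2 = setT].
Proof.
move=> conG G3; have [P maxP] := max_packing_exists.
have [B leBP domB] := max_packing_centers maxP; exists B; split.
- rewrite card_gt0; apply: contraNneq (max_packing_nonempty maxP conG G3) => B0.
  rewrite -domB B0; apply/eqP/setP=> x; rewrite in_set0.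
  by apply/negbTE/domination_stepP=> -[|[v]]; rewrite inE.
- rewrite leq_divRL // mulnC; apply: leq_trans (max_packing_card maxP).
  by rewrite leq_mul2l leBP.
apply/setP=> u; rewrite [RHS]inE /= domB inE.
have [//|nDu] := boolP (u \in cover P); rewrite /= inE.
have := in_setT u; rewrite -(max_packing_nbhd_full maxP conG G3).
case/domination_stepP=> [Du | [v Dv vu]]; first by rewrite Du in nDu.
(* The first step fills exactly the cover, so [u] is the unique unfilled neighbour of [v]. *)
apply/existsP; exists v; rewrite Dv; apply/eqP/setP=> x; rewrite !inE.
apply/andP/eqP=> [[vx nDx] | -> //].
exact: (max_packing_uniq maxP Dv vx vu nDx nDu).
Qed.

End StarPacking.

(** * Bounds on the throttling number *)

Section Throttling.
Variable G : sgraph.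
Implicit Types B : {set G}.

Lemma pd_pt_le B t : filled B t = setT -> (pd_pt B <= t%:Z%:E)%E.
Proof.
move=> fBt; rewrite /pd_pt; case: pselect => [ex_t | []]; last by exists t; rewrite fBt.
by case: ex_minnP => m _ /(_ t) le_mt; rewrite lee_fin lez_nat le_mt // fBt.
Qed.

Lemma pd_pt_ge0 B : (0 <= pd_pt B)%E.
Proof. by rewrite /pd_pt; case: pselect => [ex_t | _]; rewrite ?lee_fin ?leey. Qed.

Lemma pd_pt_ge1 B : B != setT -> (1 <= pd_pt B)%E.
Proof.
move=> BnT; rewrite /pd_pt; case: pselect => [ex_t | _]; last by rewrite leey.
by case: ex_minnP => -[|m]; rewrite ?(negPf BnT) // lee_fin lez_nat.
Qed.

Lemma pd_throttling_le B t : 0 < #|B| -> filled B t = setT ->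
  (pd_throttling G <= (#|B| + t)%N%:Z%:E)%E.
Proof.
move=> B0 fBt; apply: (Order.TotalTheory.bigmin_inf_seq _ #|B|) => //.
  by rewrite mem_index_iota B0 ltnS max_card.
apply: (Order.TotalTheory.bigmin_inf B); first exact: eqxx.
by rewrite PoszD EFinD leeD2l // pd_pt_le.
Qed.

(** The starting value [+oo] of both minima is above every [m]. *)
Lemma pd_throttling_ge (m : \bar int) :
  (forall B, 0 < #|B| -> (m <= #|B|%:Z%:E + pd_pt B)%E) -> (m <= pd_throttling G)%E.
Proof.
move=> mB; rewrite /pd_throttling big_nat_cond.
apply: Order.POrderTheory.le_bigmin => [|k /andP[/andP[k0 _] _]]; first exact: leey.
apply: Order.POrderTheory.le_bigmin => [|B /eqP Bk]; first exact: leey.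
by apply: mB; rewrite Bk.
Qed.

Lemma pd_throttling_upper : graph_connected G ->
  (pd_throttling G <= (#|G| %/ 3 + 2)%N%:Z%:E)%E.
Proof.
move=> conG; have [G3 | G2] := ltnP 2 #|G|.
  have [B [B0 leB fB]] := two_step_power_domination conG G3.
  apply: Order.POrderTheory.le_trans (pd_throttling_le B0 fB) _.
  by rewrite lee_fin lez_nat leq_add2r.
(* For order at most 2, filling all vertices at time 0 already costs at most 2. *)
have leT : (pd_throttling G <= (#|[set: G]| + 0)%N%:Z%:E)%E.
  by apply: pd_throttling_le; rewrite // cardsT vertex_gt0.
apply: Order.POrderTheory.le_trans leT _.
by rewrite lee_fin lez_nat cardsT addn0 (leq_trans G2) // leq_addl.
Qed.

End Throttling.

(** * Sharpness on the complete graph of order 2 *)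

Section K2.

Let adjK2 (x y : bool) := x != y.

Let adjK2_sym : symmetric adjK2.
Proof. by move=> x y; rewrite /adjK2 eq_sym. Qed.

Let adjK2_irr : irreflexive adjK2.
Proof. by move=> x; rewrite /adjK2 eqxx. Qed.

Let K2_gt0 : 0 < #|{: bool}|.
Proof. by rewrite card_bool. Qed.

Definition K2 : sgraph := SGraph adjK2_sym adjK2_irr K2_gt0.

Lemma card_K2 : #|K2| = 2.
Proof. exact: card_bool. Qed.

Lemma K2_connected : graph_connected K2.
Proof.
move=> x y; have [-> | xy] := eqVneq x y; first exact: connect0.
exact: connect1.
Qed.

(** The whole vertex set costs 2 + 0, and any other nonempty set at least 1 + 1. *)
Lemma pd_throttling_K2 : pd_throttling K2 = 2%:E%E.
Proof.
apply/eqP; rewrite Order.POrderTheory.eq_le; apply/andP; split.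
  by have := pd_throttling_upper K2_connected; rewrite card_K2.
apply: pd_throttling_ge => B B0.
have [-> | BnT] := eqVneq B setT.
  by rewrite cardsT card_K2; apply: leeDl; apply: pd_pt_ge0.
by rewrite -[leLHS]/(1%:E + 1%:E)%E; apply: leeD (pd_pt_ge1 BnT); rewrite lee_fin lez_nat.
Qed.

End K2.

Theorem theorem2p8 :
  (forall (n : nat) (G : sgraph), #|G| = n -> graph_connected G ->
     (pd_throttling G <= (n %/ 3 + 2)%N%:Z%:E)%E) /\
  (exists (n : nat) (G : sgraph),
     [/\ #|G| = n, graph_connected G &
         pd_throttling G = ((n %/ 3 + 2)%N%:Z%:E)%E]).
Proof.
split=> [n G <- | ]; first exact: pd_throttling_upper.
by exists 2, K2; split; [exact: card_K2 | exact: K2_connected | exact: pd_throttling_K2].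
Qed.
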